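(* Let $L\ge 2$ be an integer and let $\pi$ be a permutation of $\{1,\dots,L\}$. For the left-right two-color initial condition, there exists a variable IET $T_{L,\pi}$ (that is, a choice of cut locations $c_{Nj}$, $N\ge 1$, $1\le j\le L-1$) that creates $L-1$ new segments per iteration if and only if $L$ is odd and $\pi$ is, or is a rotation of, a permutation of the following form (written in one-line notation): $$1\;\pi_2(n+2)\left[\prod_{i=2}^{k}\pi_1(i)\,\pi_2(i+n+1)\right](n+1)\left[\prod_{i=k+1}^{n}\pi_1(i)\,\pi_2(i+n+1)\right],$$ where $n=(L-1)/2$, $\pi_1$ is a permutation of the set $\{2,\dots,n\}$, $\pi_2$ is a permutation of the set $\{n+2,\dots,L=2n+1\}$, and $1\le k\le n$. Here the product symbol denotes concatenation of words in increasing order of $i$ (an empty product is the empty word).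
   Context: Left-right two-color initial condition: the line interval $[0,1]$ with its left half $[0,1/2)$ colored black and its right half $(1/2,1]$ colored gray. One-line notation: a permutation $\pi$ of $\{1,\dots,L\}$ is written as the word $\pi(1)\pi(2)\cdots\pi(L)$. Variable IET: a variable interval exchange transformation $T_{L,\pi}$ consists of a fixed permutation $\pi$ of $\{1,\dots,L\}$ together with cut locations $0<c_{N1}<c_{N2}<\dots<c_{N,L-1}<1$ for each iteration $N\ge 1$ (the cut locations may be different at each iteration). At iteration $N$ the current colored line is cut at the points $c_{N1},\dots,c_{N,L-1}$ into $L$ pieces $p_1,\dots,p_L$ (numbered from left to right), and the pieces are reassembled, by translation and without reflection, into a line of length $1$ in the left-to-right order $p_{\pi(1)},p_{\pi(2)},\dots,p_{\pi(L)}$; the result is the input to iteration $N+1$. The initial condition is the input to iteration $1$. Colors at the finitely many interface and cut points are disregarded. Segments: a segment is a maximal connected monochromatic part of the line, where the two ends $0$ and $1$ of the line are identified (periodic boundary conditions), so that parts of the same color at the start and at the end of the line are connected and count as one segment. Thus the initial condition has $2$ segments. The IET creates $L-1$ new segments per iteration if, for every $N\ge1$, the number of segments after iteration $N$ equals the number of segments before iteration $N$ plus $L-1$. Rotation of a permutation: a rotation of a permutation $\pi$ of $\{1,\dots,L\}$ is a permutation $\tau$ of the form $\tau(i)=\pi(i+r \bmod L)$ for some integer $r$, with residues mod $L$ taken in $\{1,\dots,L\}$. *)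

(* Defs.v *)
From HB Require Import structures.
From mathcomp Require Import all_boot all_order all_algebra all_fingroup.
From mathcomp Require Import generic_quotient finmap.
From mathcomp Require Import all_classical all_reals all_analysis.

Set Implicit Arguments.
Unset Strict Implicit.
Unset Printing Implicit Defensive.

Import Order.TTheory GRing.Theory Num.Theory.
Import numFieldNormedType.Exports.

Local Open Scope quotient_scope.
Local Open Scope classical_set_scope.
Local Open Scope ring_scope.

Inductive color := Black | Gray.

(* A colored line is a function on R of which only the values on [0, 1[ are
   meaningful. Pieces are half-open on the right, so that the color at an
   interface or cut point is the color of the part to its right; this is how
   the colors at these finitely many points are disregarded. *)
Definition coloring (R : realType) := R -> color.

Definition left_right (R : realType) : coloring R :=
  fun x => if x < 1 / 2 then Black else Gray.

(* [0, 1] with its two ends identified, as the topological quotient R / Z, of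
   which [0, 1[ is a fundamental domain. *)
Section circle.
Variable R : realType.

Definition eq_mod1 (x y : R) : bool := x - y \is a Num.int.

Lemma eq_mod1_refl : reflexive eq_mod1.
Proof. by move=> x; rewrite /eq_mod1 subrr rpred0. Qed.

Lemma eq_mod1_sym : symmetric eq_mod1.
Proof. by move=> x y; rewrite /eq_mod1 -opprB rpredN. Qed.

Lemma eq_mod1_trans : transitive eq_mod1.
Proof.
move=> y x z; rewrite /eq_mod1 => xy yz.
by rewrite -(subrK y x) -addrA rpredD.
Qed.

Definition mod1 : equiv_rel R :=
  EquivRel eq_mod1 eq_mod1_refl eq_mod1_sym eq_mod1_trans.

Definition circle := quotient_topology {eq_quot mod1}.

HB.instance Definition _ := Topological.on circle.

Definition to_circle (x : R) : circle := \pi_({eq_quot mod1}) x.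

End circle.

Definition monochromatic (R : realType) (f : coloring R)
    (A : set (circle R)) : Prop :=
  forall x y : R, 0 <= x < 1 -> 0 <= y < 1 ->
    A (to_circle x) -> A (to_circle y) -> f x = f y.

Definition segment (R : realType) (f : coloring R)
    (A : set (circle R)) : Prop :=
  [/\ connected A, monochromatic f A &
      forall B : set (circle R), connected B -> monochromatic f B ->
        A `<=` B -> B = A].

(* fset_set, hence nb_segments, has the junk value fset0, resp. 0, on an
   infinite set. *)
Definition nb_segments (R : realType) (f : coloring R) : nat :=
  #|` fset_set [set A | segment f A]|%fset.

(* The cuts c 1 < ... < c (L - 1) of one iteration, extended by the two ends
   c 0 = 0 and c L = 1 of the line; c is irrelevant above L. Piece j, counted
   from 0, is [c j, c j.+1[. *)
Definition valid_cuts (R : realType) (L : nat) (c : nat -> R) : Prop :=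
  [/\ c 0%N = 0, c L = 1 & forall j : nat, (j < L)%N -> c j < c j.+1].

(* Length of the piece put in slot i, slots being counted from 0 as well. *)
Definition slot_len (R : realType) (L : nat) (p : 'S_L) (c : nat -> R)
    (i : 'I_L) : R :=
  c (p i).+1 - c (p i).

Definition slot_start (R : realType) (L : nat) (p : 'S_L) (c : nat -> R)
    (i : 'I_L) : R :=
  \sum_(j < L | (j < i)%N) slot_len p c j.

(* Position, before the reassembly, of the point which is at x after it. *)
Definition iet_source (R : realType) (L : nat) (p : 'S_L) (c : nat -> R)
    (x : R) : R :=
  if [pick i : 'I_L |
        slot_start p c i <= x < slot_start p c i + slot_len p c i] is Some i
  then c (p i) + (x - slot_start p c i) else x.

Definition iet_step (R : realType) (L : nat) (p : 'S_L) (c : nat -> R)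
    (f : coloring R) : coloring R :=
  fun x => f (iet_source p c x).

(* The line after N iterations; iteration N >= 1 uses the cuts c N. *)
Fixpoint iet_state (R : realType) (L : nat) (p : 'S_L) (c : nat -> nat -> R)
    (f0 : coloring R) (N : nat) : coloring R :=
  if N is N'.+1 then iet_step p (c N) (iet_state p c f0 N') else f0.

Definition creates_segments (R : realType) (L : nat) (p : 'S_L)
    (c : nat -> nat -> R) (f0 : coloring R) : Prop :=
  forall N : nat, (1 <= N)%N ->
    nb_segments (iet_state p c f0 N) =
      (nb_segments (iet_state p c f0 N.-1) + (L - 1))%N.

(* One-line notation, on {1, ..., L}; 'S_L acts on {0, ..., L - 1}. *)
Definition one_line (L : nat) (p : 'S_L) : seq nat :=
  [seq (p i : nat).+1 | i <- enum 'I_L].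

Definition perm_of_range (a b : nat) (f : nat -> nat) : Prop :=
  set_bij [set i : nat | (a <= i <= b)%N] [set i : nat | (a <= i <= b)%N] f.

Definition special_word (n k : nat) (p1 p2 : nat -> nat) : seq nat :=
  [:: 1; p2 (n + 2)]%N
  ++ flatten [seq [:: p1 i; p2 (i + n + 1)%N] | i <- index_iota 2 k.+1]
  ++ [:: (n + 1)%N]
  ++ flatten [seq [:: p1 i; p2 (i + n + 1)%N] | i <- index_iota k.+1 n.+1].

Definition special_form (L : nat) (p : 'S_L) : Prop :=
  let n := ((L - 1) %/ 2)%N in
  exists (p1 p2 : nat -> nat) (k : nat),
    [/\ perm_of_range 2 n p1, perm_of_range (n + 2) L p2, (1 <= k <= n)%N &
        one_line p = special_word n k p1 p2].

(* t i = p (i + r mod L); shifting all indices by 1 does not affect this. *)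
Definition rotation_of (L : nat) (p t : 'S_L) : Prop :=
  exists r : int, forall i j : 'I_L,
    (j%:Z = i%:Z + r %[mod L%:Z])%Z -> t i = p j.

(* Main.v *)
(* The point 0 of the circle is always a cut point, and it is a color boundary
   of the initial condition. Each iteration can destroy the boundaries at its L
   cut points (0 included) and create one at each of its L junctions, so the
   first iteration gains L - 1 segments if and only if every junction is a
   boundary and 0 is the only boundary that is cut, in particular 1/2 is not.
   Then exactly one piece m is two-colored, and the junction condition says
   that, in cyclic order, the pieces smaller and larger than m alternate, with
   m inserted between a larger and a smaller one: this is the special form up
   to rotation.
   Conversely the new line again starts and ends with different colors, so the
   next iteration can put m cuts in the first segment and L - 1 - m cuts in the
   last one, and the same argument applies forever. *)

Require Import Defs.
From mathcomp Require Import all_boot all_order all_algebra all_fingroup.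
From mathcomp Require Import generic_quotient zify lra.
From mathcomp Require Import all_classical all_reals all_analysis.

Set Implicit Arguments.
Unset Strict Implicit.
Unset Printing Implicit Defensive.

Import Order.TTheory GRing.Theory Num.Theory.
Import numFieldNormedType.Exports.

Local Open Scope quotient_scope.
Local Open Scope classical_set_scope.
Local Open Scope ring_scope.

(** * Combinatorics of the alternation condition and of the special form *)

Section Combinatorics.
Local Open Scope nat_scope.

(* Counting pieces from 0, the cut structure of one iteration is determined by
   the piece m whose two ends have different colors: the pieces before it start
   and end in the color of the left end of the line, the pieces after it in the
   color of the right end. All junctions are then boundaries if and only if the
   following holds. *)
Definition alternates (m L : nat) (p : 'S_L) : Prop :=
  forall i : 'I_L, (p i < m) = (m < p (ordS i)).

(** Both sides of the condition are counted over all slots: since [p] and [ordS] are bijective, [m]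
    slots satisfy the left one and [L - m - 1] slots the right one. *)
Lemma alternates_size (m L : nat) (p : 'S_L) :
  m < L -> alternates m p -> L = m.*2.+1.
Proof.
move=> mL alt.
have card_lt k : k <= L -> #|[set i : 'I_L | i < k]%SET| = k.
  by move=> kL; rewrite cardsE -sum1_card (big_ord_narrow kL) sum1_card card_ord.
have E : [set i | p i < m]%SET = [set i | m < p (ordS i)]%SET.
  by apply/setP => i; rewrite !inE alt.
have lo : #|[set i | p i < m]%SET| = m.
  rewrite -[RHS](card_lt m (ltnW mL)) -[RHS](card_preimset _ (@perm_inj _ p)).
  by congr #|pred_of_set _|; apply/setP => i; rewrite !inE.
have hi : #|[set i | m < p (ordS i)]%SET| = L - m.+1.
  have := cardsC [set i : 'I_L | i < m.+1]%SET; rewrite card_lt // card_ord.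
  have inj : injective (fun i : 'I_L => p (ordS i)).
    by move=> i j /perm_inj /ordS_inj.
  rewrite -[#|~: _|](card_preimset _ inj) => LE.
  rewrite -[X in X - _]LE addKn; congr #|pred_of_set _|; apply/setP => i.
  by rewrite !inE -leqNgt.
by move: hi; rewrite -E lo -addnn; lia.
Qed.

Lemma val_iter_ordS (L : nat) (i : 'I_L) (z : nat) :
  val (iter z (@ordS L) i) = (i + z) %% L.
Proof.
elim: z => [|z IHz]; first by rewrite addn0 modn_small.
by rewrite iterS /= IHz addnS -addn1 modnDml addn1.
Qed.

(** Shifting [p] by [z] slots gives [q]. In [rotation_of q p] it is [p] that is a rotation of [q],
    so the offset is [- z]. *)
Lemma rotation_iter (L : nat) (p : 'S_L) (z : nat) :
  exists2 q : 'S_L, rotation_of q p & forall i, q i = p (iter z (@ordS L) i).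
Proof.
pose s := perm (@ordS_inj L).
have qE i : (s ^+ z * p)%g i = p (iter z (@ordS L) i).
  rewrite permM permX; congr (p _).
  by elim: z => //= z ->; rewrite permE.
exists (s ^+ z * p)%g => //; exists (- z%:Z)%R => i j ij; rewrite qE.
congr (p _); apply: val_inj; rewrite val_iter_ordS.
have : (j%:Z + z%:Z = i%:Z %[mod L%:Z])%Z.
  by rewrite -modzDml ij modzDml subrK.
by rewrite -PoszD !modz_nat => -[->]; rewrite modn_small.
Qed.

(** The condition only relates cyclic neighbours, and a shift mod [L] commutes with [ordS]. *)
Lemma alternates_rotation (m L : nat) (s p : 'S_L) :
  rotation_of s p -> alternates m s -> alternates m p.
Proof.
move=> [r pr] alt i; have L0 : 0 < L by apply: leq_ltn_trans (ltn_ord i).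
have jP : `|((i%:Z + r) %% L%:Z)%Z|%N < L.
  by rewrite -ltz_nat gez0_abs ?modz_ge0 ?ltz_pmod //; lia.
pose j := Ordinal jP.
have jE : (j%:Z = i%:Z + r %[mod L%:Z])%Z.
  by rewrite /= gez0_abs ?modz_mod // modz_ge0 //; lia.
rewrite (pr i j jE) (pr (ordS i) (ordS j)) //=.
rewrite -!modz_nat modz_mod -addn1 PoszD -modzDml jE modzDml.
by rewrite modzDml -(addn1 i) PoszD addrAC.
Qed.

Definition pairs_word (f g : nat -> nat) (s : seq nat) : seq nat :=
  flatten [seq [:: f i; g i] | i <- s].

(** Pair number [i] fills the position [2(i - 1) + o] of a word [h] and the next one. The offset [o]
    will be 0 before the entry [n + 1] of the special form and 1 after it. *)
Lemma pairs_word_iota (f g h : nat -> nat) (o a n : nat) : 0 < a ->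
  (forall i, a <= i < a + n ->
     f i = h (i.-1.*2 + o) /\ g i = h (i.-1.*2 + o).+1) ->
  pairs_word f g (iota a n) = [seq h j | j <- iota (a.-1.*2 + o) n.*2].
Proof.
elim: n a => // n IHn a a0 fg; have [|fa ga] := fg a; first by lia.
rewrite /pairs_word /= fa ga; congr [:: _, _ & _].
have -> : (a.-1.*2 + o).+2 = a.+1.-1.*2 + o by lia.
by apply: IHn => // i ai; apply: fg; lia.
Qed.

Section Cycle.
Variable n : nat.
(** The condition of [alternates n] on one-line values: these count from 1, so [v <= n] is a piece
    before [n] and [n.+1 < v] a piece after it. *)
Let e : rel nat := fun a b => (a <= n) == (n.+1 < b).

(** The word is entered from a value above [n], and each pair again ends above [n], so the invariant
    passes to the next pair. *)
Lemma path_pairs_word (f g : nat -> nat) (s : seq nat) (x : nat) :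
  {in s, forall i, f i <= n /\ n.+1 < g i} -> n < x ->
  path e x (pairs_word f g s) && (n < last x (pairs_word f g s)).
Proof.
elim: s x => [|i s IHs] x fg nx /=; first by rewrite nx.
have [fi gi] := fg i (mem_head _ _).
have -> : e x (f i) by rewrite /e; lia.
have -> : e (f i) (g i) by rewrite /e; lia.
by apply: IHs => [j js|]; [apply: fg; rewrite inE js orbT | lia].
Qed.

(** An entry at most [n] is followed by one above [n + 1], and any other entry, [n + 1] included, by
    one at most [n + 1]. The word closes up because it ends above [n] and starts with 1. *)
Lemma cycle_special_word (k : nat) (p1 p2 : nat -> nat) :
  1 <= k <= n ->
  (forall i, 2 <= i <= n -> p1 i <= n) ->
  (forall i, n + 2 <= i <= n.*2.+1 -> n.+1 < p2 i) ->
  path.cycle e (special_word n k p1 p2).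
Proof.
move=> kn p1n p2n; rewrite /special_word /=.
rewrite -![flatten _]/(pairs_word _ (fun i => p2 (i + n + 1)) _).
set s1 := index_iota _ _; set s2 := index_iota _ _.
have fg1 : {in s1, forall i, p1 i <= n /\ n.+1 < p2 (i + n + 1)}.
  by move=> i; rewrite mem_index_iota => ?; split; [apply: p1n | apply: p2n]; lia.
have fg2 : {in s2, forall i, p1 i <= n /\ n.+1 < p2 (i + n + 1)}.
  by move=> i; rewrite mem_index_iota => ?; split; [apply: p1n | apply: p2n]; lia.
have p22 : n.+1 < p2 (n + 2) by apply: p2n; lia.
rewrite rcons_cat cat_path /=.
have /andP[-> l1] := path_pairs_word fg1 (ltnW p22).
have /andP[path2 l2] := path_pairs_word fg2 (leqnn n.+1).
rewrite rcons_path !addn1 path2 /e /=; lia.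
Qed.

End Cycle.

Lemma cycle_nth (T : Type) (r : rel T) (x0 : T) (w : seq T) (i : nat) :
  path.cycle r w -> i < size w -> r (nth x0 w i) (nth x0 w (i.+1 %% size w)).
Proof.
case: w => // x s /= /(pathP x0) + si; move=> /(_ i); rewrite size_rcons.
move=> /(_ si); rewrite -rcons_cons nth_rcons /= si nth_rcons.
have [|is_] := ltnP i (size s); first by move=> ?; rewrite modn_small //=.
have -> : i = size s by apply/eqP; rewrite eqn_leq is_ -ltnS si.
by rewrite eqxx modnn.
Qed.

Lemma nth_one_line (L : nat) (p : 'S_L) (i : 'I_L) :
  nth 0 (one_line p) i = (p i).+1.
Proof. by rewrite (nth_map i) ?size_enum_ord // nth_ord_enum. Qed.

Lemma special_alternates (L : nat) (p : 'S_L) :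
  odd L -> special_form p -> alternates ((L - 1) %/ 2) p.
Proof.
move=> oL [p1 [p2 [k [[p1f _ _] [p2f _ _] kn pw]]]] i.
set n := (_ %/ 2) in p1f p2f kn pw *; have Ln : L = n.*2.+1 by lia.
have : path.cycle (fun a b => (a <= n) == (n.+1 < b)) (one_line p).
  rewrite pw; apply: cycle_special_word => //.
    by move=> j /p1f /andP[].
  by move=> j; rewrite -Ln => /p2f /andP[+ _]; rewrite addn2.
have sL : size (one_line p) = L by rewrite size_map size_enum_ord.
move=> /(cycle_nth 0 (i := i)); rewrite sL => /(_ (ltn_ord i)).
by rewrite -[_ %% L]/(val (ordS i)) !nth_one_line => /eqP.
Qed.

(* From position 0 the pieces before n, which we call low, and the pieces after
   n alternate; passing the piece n shifts the parity. *)
Lemma alternation_parity (n : nat) (h : nat -> nat) (s : nat) :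
  h 0 = 0 -> 0 < n -> s <= n.*2 -> h s = n ->
  (forall j, j <= n.*2 -> h j = n -> j = s) ->
  (forall j, j < n.*2 -> (h j < n) = (n < h j.+1)) ->
  (h n.*2 < n) = false ->
  exists k, [/\ 1 <= k <= n, s = k.*2,
    forall i, i < k -> h i.*2 < n /\ n < h i.*2.+1 &
    forall i, k <= i < n -> h i.*2.+1 < n /\ n < h i.+1.*2].
Proof.
move=> h0 n0 sn hs suniq alt last_hi.
have neq j : j <= n.*2 -> j != s -> h j != n.
  by move=> jn; apply: contra => /eqP /(suniq _ jn) ->.
have before j : j < s -> (h j < n) = ~~ odd j.
  elim: j => [|j IHj] js; first by rewrite h0 n0.
  have := neq j.+1; have := alt j; rewrite IHj ?(ltnW js) //=; lia.
have s0 : s != 0 by apply: contraTneq n0 => s0; rewrite -hs s0 h0.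
have even_s : ~~ odd s.
  have := alt s.-1; rewrite before ?prednK; lia.
have after d : s.+1 + d <= n.*2 -> (h (s.+1 + d) < n) = ~~ odd d.
  elim: d => [|d IHd] sd.
    by rewrite addn0 in sd *; have := alt s; have := neq s.+1; lia.
  rewrite addnS in sd *; have := neq (s.+1 + d).+1; have := alt (s.+1 + d).
  rewrite IHd /=; lia.
exists s./2; have sE : s = s./2.*2 by rewrite even_halfK.
split=> // [|i ik|i ik]; first lia.
  have lo : h i.*2 < n by rewrite before ?odd_double //; lia.
  by split=> //; rewrite -alt //; lia.
have lo : h i.*2.+1 < n.
  have -> : i.*2.+1 = s.+1 + (i - s./2).*2 by lia.
  by rewrite after ?odd_double //; lia.
by split=> //; rewrite doubleS -alt //; lia.
Qed.

(** With piece 0 in slot 0 the word starts with 1, and [alternation_parity] tells which of the other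
    positions hold low and high pieces. *)
Lemma alternates_special (n L : nat) (p : 'S_L) (i0 : 'I_L) :
  L = n.*2.+1 -> 0 < n -> i0 = 0 :> nat -> p i0 = 0 :> nat ->
  alternates n p -> special_form p.
Proof.
move=> Ln; subst L => n0 i00 pi0 alt.
pose h j := p (inord j) : nat.
have hp (i : 'I_n.*2.+1) : h i = p i by rewrite /h inord_val.
have h0 : h 0 = 0 by have := hp i0; rewrite i00 pi0.
have hle j : h j <= n.*2 by rewrite -ltnS ltn_ord.
have hinj i j : i <= n.*2 -> j <= n.*2 -> h i = h j -> i = j.
  move=> ni nj /val_inj /perm_inj /(congr1 val) /=; rewrite !inordK //.
have hsurj v : v <= n.*2 -> exists2 j, j <= n.*2 & h j = v.
  move=> nv; exists (p^-1%g (inord v)); first by rewrite -ltnS.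
  by rewrite hp permKV inordK.
have [s sn hs] := hsurj n ltac:(lia).
have halt j : j < n.*2 -> (h j < n) = (n < h j.+1).
  move=> jn; rewrite /h alt; congr (n < p _); apply: val_inj => /=.
  by rewrite !inordK ?modn_small //; lia.
have hlast : (h n.*2 < n) = false.
  rewrite /h alt [X in p X](_ : _ = i0) ?pi0 ?ltn0 //; apply: val_inj.
  by rewrite /= inordK // modnn.
have [|k [kn sk before after]] := alternation_parity h0 n0 sn hs _ halt hlast.
  by move=> j jn hj; apply: hinj; rewrite // hj.
(* [q1 i] and [q2 x] are the positions, from 0, of the letters [p1 i] and [p2 x] of the special
   form. From pair [k + 1] on they are one further to the right, because the entry [n + 1] sits at
   position [s = 2k]. *)
pose q1 i := if i <= k then i.-1.*2 else i.-1.*2.+1.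
pose q2 x := let i := x - n.+1 in if i <= k then i.-1.*2.+1 else i.*2.
have q1lo i : 1 <= i <= n -> h (q1 i) < n.
  rewrite /q1 => i1; case: (leqP i k) => ik; first by have [|] := before i.-1; first lia.
  by have [|] := after i.-1; first lia.
have q2hi i : n + 2 <= i <= n.*2.+1 -> n < h (q2 i).
  rewrite /q2 => i1; case: (leqP _ k) => ik.
    by have [|_] := before (i - n.+1).-1; first lia.
  by have [|_] := after (i - n.+1).-1; first lia; rewrite prednK //; lia.
(* These positions and [s] exhaust the word. They carry low pieces, high pieces and [n]
   respectively, so surjectivity of [p1] and [p2] will follow from that of [h]. *)
have par j : j <= n.*2 ->
    [\/ exists2 i, 1 <= i <= n & j = q1 i, j = s |
        exists2 i, n + 2 <= i <= n.*2.+1 & j = q2 i].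
  rewrite /q1 /q2 sk => jn.
  have [jk|jk|->] := ltngtP j k.*2; last by constructor 2.
    have [oj|oj] := boolP (odd j).
      constructor 3; exists (j./2 + n + 2); first lia.
      by rewrite ifT; lia.
    by constructor 1; exists j./2.+1; [lia | rewrite ifT; lia].
  have [oj|oj] := boolP (odd j).
    by constructor 1; exists j./2.+1; [lia | rewrite ifF; lia].
  by constructor 3; exists (j./2 + n + 1); [lia | rewrite ifF; lia].
rewrite /special_form /=.
have -> : (n.*2.+1 - 1) %/ 2 = n by lia.
exists (fun i => (h (q1 i)).+1), (fun i => (h (q2 i)).+1), k; split=> //.
- split.
  + move=> i /= i2; have := q1lo i; have : h (q1 i) != 0; last by lia.
    apply/eqP; rewrite -h0 => /hinj; rewrite /q1; case: (leqP i k) => ik; lia.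
  + move=> i j; rewrite !inE /= => i2 j2 [] /hinj; rewrite /q1.
    by case: (leqP _ k) => ?; case: (leqP _ k) => ?; lia.
  + move=> v /= v2; have [j jn hj] := hsurj v.-1 ltac:(lia).
    have [[i i1 ji]|js|[i i1 ji]] := par j jn.
    * exists i; last by rewrite -ji; lia.
      (* Position [q1 1] is 0 and holds piece 0, the leading 1 of the word, which is outside the
         range of [p1]. *)
      rewrite /=; suff : i != 1 by lia.
      apply/eqP => i1E; move: hj; rewrite ji i1E /q1 ifT /= ?double0 ?h0; lia.
    * by move: hj; rewrite js hs; lia.
    * by have := q2hi i i1; rewrite -ji hj; lia.
- split.
  + by move=> i /= i2; have := q2hi i; have := hle (q2 i); lia.
  + move=> i j; rewrite !inE /= => i2 j2 [] /hinj; rewrite /q2.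
    by case: (leqP _ k) => ?; case: (leqP _ k) => ?; lia.
  + move=> v /= v2; have [j jn hj] := hsurj v.-1 ltac:(lia).
    have [[i i1 ji]|js|[i i1 ji]] := par j jn.
    * by have := q1lo i i1; rewrite -ji hj; lia.
    * by move: hj; rewrite js hs; lia.
    * by exists i; rewrite // -ji; lia.
(* The [2n + 1] positions split into the leading two letters, [k - 1] pairs, the entry [n + 1], and
   [n - k] pairs. *)
- have [k0 kn'] := andP kn; pose q j := (h j).+1.
  have -> : one_line p =
      [seq q j | j <- iota 0 (2 + ((k.+1 - 2).*2 + (1 + (n - k).*2)))].
    rewrite (_ : 2 + _ = n.*2.+1); last by lia.
    by rewrite -val_enum_ord -map_comp; apply: eq_map => i /=; rewrite /q hp.
  rewrite !iotaD !map_cat /special_word -![flatten _]/(pairs_word _ _ _).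
  rewrite /index_iota subSS.
  have q2E i : q2 (i + n + 1) = if i <= k then i.-1.*2.+1 else i.*2.
    by rewrite /q2 -addnA addn1 addnK.
  rewrite (@pairs_word_iota _ (fun i => (h (q2 (i + n + 1))).+1) q 0) //; last first.
    move=> i /andP[_ ik]; rewrite q2E /q /q1 !ifT ?addn0 //; lia.
  rewrite (@pairs_word_iota _ (fun i => (h (q2 (i + n + 1))).+1) q 1) //; last first.
    move=> i /andP[ik _]; rewrite q2E /q /q1 !ifF; [|lia..].
    by split; [rewrite addn1 | rewrite addn1 -doubleS prednK //; lia].
  congr (_ ++ (_ ++ (_ ++ _))).
  + rewrite /= /q h0 /q2 ifT; first by rewrite addn2 subSnn. lia.
  + by rewrite /= /q (_ : 0 + 2 + _ = s) ?hs ?addn1 //; lia.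
  + by congr (map _ (iota _ _)); lia.
Qed.

Lemma alternates_iff (L : nat) (p : 'S_L) : 1 < L ->
  (exists2 m, m < L & alternates m p) <->
  odd L /\ (special_form p \/ exists s : 'S_L, special_form s /\ rotation_of s p).
Proof.
move=> L1; split=> [[m mL alt]|[oL spec]].
  have Lm := alternates_size mL alt; split; first by rewrite Lm /= odd_double.
  have L0 : 0 < L by lia.
  (* [z] is the slot of piece 0; the rotation by [z] brings this piece to the front. *)
  pose i0 := Ordinal L0; pose z := (p^-1)%g i0 : nat.
  have [q qp qE] := rotation_iter p z.
  right; exists q; split=> //; apply: (@alternates_special m L q i0) => //; first lia.
    rewrite qE [X in p X](_ : _ = (p^-1)%g i0) ?permKV //; apply: val_inj.
    by rewrite val_iter_ordS; exact: modn_small (ltn_ord _).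
  by move=> i; rewrite !qE alt -iterS iterSr.
exists ((L - 1) %/ 2); first by lia.
case: spec => [/(special_alternates oL) //|[s [ss sp]]].
exact: alternates_rotation sp (special_alternates oL ss).
Qed.

End Combinatorics.

(** * Representatives and arcs on the circle *)

Section Circle.
Variable R : realType.
Implicit Types (x y a b : R) (f : coloring R) (A B : set (circle R)).

Lemma to_circle_eq x y : to_circle x = to_circle y <-> x - y \is a Num.int.
Proof.
split=> [/eqmodP //|xy]; exact/eqmodP.
Qed.

Lemma to_circle_shift x (z : int) : to_circle (x + z%:~R) = to_circle x.
Proof. by apply/to_circle_eq; rewrite addrAC subrr add0r intr_int. Qed.

(** The base point [a] is left free because arcs running through the point 0 of the circle need
    windows other than [[0, 1[]. *)
Lemma to_circle_surj (a : R) (q : circle R) :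
  exists2 x, a <= x < a + 1 & q = to_circle x.
Proof.
have [y ->] : exists y, q = to_circle y.
  by exists (repr (q : {eq_quot mod1 R})); rewrite /to_circle reprK.
exists (y + (- Num.floor (y - a))%:~R); last by rewrite to_circle_shift.
move: (floor_itv (y - a)); rewrite intrD intrN => ?; lra.
Qed.

(** The two representatives differ by an integer of absolute value below 1. *)
Lemma to_circle_inj a x y : a <= x < a + 1 -> a <= y < a + 1 ->
  to_circle x = to_circle y -> x = y.
Proof.
move=> hx hy /to_circle_eq /intrP [z xyz].
have : `|z%:~R : R| < 1 by rewrite -xyz ltr_norml; lra.
rewrite -intr_norm -[1]/(1%:~R) ltr_int => hz.
have z0 : z = 0 by lia.
by move: xyz; rewrite z0 => /eqP; rewrite subr_eq0 => /eqP.
Qed.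

Lemma to_circle_continuous : continuous (@to_circle R).
Proof. exact: pi_continuous. Qed.

Lemma connected_arc (i : interval R) :
  connected (@to_circle R @` [set` i]).
Proof.
apply: connected_continuous_connected.
  exact/connected_intervalP/interval_is_interval.
apply: continuous_subspaceT; exact: to_circle_continuous.
Qed.

(** In the quotient topology it is the preimage in the line that must be open; it is the union of
    all integer translates of the interval. *)
Lemma open_arc a b : open (@to_circle R @` `]a, b[).
Proof.
have -> : open (@to_circle R @` `]a, b[) =
  open (@to_circle R @^-1` (@to_circle R @` `]a, b[)) by [].
rewrite (_ : _ @^-1` _ = \bigcup_(z in [set: int]) `]a + z%:~R, b + z%:~R[%classic).
  by apply: bigcup_open => z _; exact: itv_open.
apply/seteqP; split=> [x [y]|x [z _]] /=; rewrite !in_itv /=.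
  move=> hy /to_circle_eq; rewrite -opprB rpredN => /intrP [z xyz].
  exists z => //=; rewrite in_itv /=; lra.
move=> hx; exists (x + (- z)%:~R); last exact: to_circle_shift.
by move: hx; rewrite !in_itv /= intrN => ?; lra.
Qed.

End Circle.

(** * Partitions of an interval by increasing breakpoints *)

Lemma itv_partition (R : realType) (M : nat) (t : nat -> R) (x : R) :
  t 0%N <= x < t M -> exists2 k, (k < M)%N & t k <= x < t k.+1.
Proof.
elim: M => [|M IHM] /andP[x0 xM]; first lra.
have [xM'|xM'] := ltP x (t M); last by exists M; rewrite ?ltnSn // xM' xM.
by have [|k kM kx] := IHM; [rewrite x0 xM' | exists k; rewrite // ltnS ltnW].
Qed.

Lemma itv_partition_le (R : realType) (M : nat) (t : nat -> R) (i j : nat) :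
  (forall k, (k < M)%N -> t k < t k.+1) -> (i <= j <= M)%N -> t i <= t j.
Proof.
move=> tlt; elim: j => [|j IHj] /andP[ij jM].
  by move: ij; rewrite leqn0 => /eqP->.
move: ij; rewrite leq_eqVlt => /orP[/eqP->//|ij].
by apply: le_trans (IHj _) (ltW (tlt _ _)) => //; rewrite -ltnS ij /= ltnW.
Qed.

Lemma itv_partition_uniq (R : realType) (M : nat) (t : nat -> R) (i j : nat)
    (x : R) :
  (forall k, (k < M)%N -> t k < t k.+1) -> (i < M)%N -> (j < M)%N ->
  t i <= x < t i.+1 -> t j <= x < t j.+1 -> i = j.
Proof.
move=> tlt; wlog ij : i j / (i <= j)%N.
  move=> H iM jM xi xj; have [ij|ij] := leqP i j; first exact: H.
  by apply/esym/H => //; apply: ltnW.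
move=> iM jM xi xj; move: ij; rewrite leq_eqVlt => /orP[/eqP//|ij].
have : t i.+1 <= t j by apply: (itv_partition_le tlt); rewrite ij ltnW.
by move=> ?; exfalso; lra.
Qed.

(** * Segments and their number *)

Section Segments.
Variable R : realType.
Implicit Types (x y : R) (f : coloring R) (A B S : set (circle R)).

Lemma monochromaticU f A B : A `&` B !=set0 -> monochromatic f A ->
  monochromatic f B -> monochromatic f (A `|` B).
Proof.
move=> [q [Aq Bq]] mA mB x y hx hy.
have [z hz zq] := to_circle_surj 0 q; rewrite add0r in hz; subst q.
have toz u : 0 <= u < 1 -> (A `|` B) (to_circle u) -> f u = f z.
  by move=> hu [?|?]; [exact: mA | exact: mB].
by move=> Ax Ay; rewrite (toz _ hx Ax) (toz _ hy Ay).
Qed.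

(** Since the two sets meet, their union is still connected and monochromatic, and maximality of [S]
    applies. *)
Lemma segment_absorb f S A : segment f S -> connected A ->
  monochromatic f A -> S `&` A !=set0 -> A `<=` S.
Proof.
move=> [cS mS maxS] cA mA SA; apply/setUidPl/maxS; last exact: subsetUl.
  exact: connectedU.
exact: monochromaticU.
Qed.

(** The empty set is connected and monochromatic, but it is not maximal: a singleton is larger. *)
Lemma segment_nonempty f S : segment f S -> S !=set0.
Proof.
move=> [_ _ maxS]; apply: contrapT => /set0P/negP/negPn/eqP S0.
have : [set to_circle (0 : R)] = S.
  apply: maxS; first exact: connected1.
    move=> x y hx hy /= x0 y0; congr (f _).
    by apply: (@to_circle_inj R 0); rewrite ?add0r // x0 y0.
  by rewrite S0.
by rewrite S0 => /seteqP[/(_ _ erefl)].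
Qed.

Lemma segment_eq f S1 S2 : segment f S1 -> segment f S2 ->
  S1 `&` S2 !=set0 -> S1 = S2.
Proof.
move=> s1 s2 S12; apply/seteqP; split.
  by have [c1 m1 _] := s1; apply: segment_absorb s2 c1 m1 _; rewrite setIC.
by have [c2 m2 _] := s2; exact: segment_absorb s1 c2 m2 S12.
Qed.

(** Distinct segments are disjoint, so a nonempty [G k] lies in at most one of them; sending [k] to
    that segment reaches all segments. *)
Lemma nb_segments_le f (K : nat) (G : nat -> set (circle R)) :
  (forall k, (k < K)%N -> G k !=set0) ->
  (forall S, segment f S -> exists2 k, (k < K)%N & G k `<=` S) ->
  (nb_segments f <= K)%N.
Proof.
move=> G0 segG; apply: geq_card_fset_set.
pose g k := [get S | segment f S /\ G k `<=` S].
apply: card_le_trans (card_image_le g `I_K).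
apply: subset_card_le => S /= sS; have [k kK GkS] := segG _ sS.
exists k => //; have [sg Gg] : segment f (g k) /\ G k `<=` g k.
  by apply: (getPex (P := fun S => segment f S /\ G k `<=` S)); exists S.
have [q Gkq] := G0 _ kK.
by apply: segment_eq sg sS _; exists q; split; [exact: Gg | exact: GkS].
Qed.

(** Neighbouring arcs may have the same color, so [M] is in general only an upper bound for the
    number of segments. *)
Definition arcs f (M : nat) (t : nat -> R) : Prop :=
  [/\ t 0%N = 0, t M = 1, forall k, (k < M)%N -> t k < t k.+1 &
      forall k x, (k < M)%N -> t k <= x < t k.+1 -> f x = f (t k)].

Definition arc (t : nat -> R) (k : nat) : set (circle R) :=
  @to_circle R @` `[t k, t k.+1[.

Section Arcs.
Variables (f : coloring R) (M : nat) (t : nat -> R).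
Hypothesis ft : arcs f M t.

Let t0 : t 0%N = 0. Proof. by case: ft. Qed.
Let tM : t M = 1. Proof. by case: ft. Qed.
Let tlt k : (k < M)%N -> t k < t k.+1. Proof. by case: ft => _ _ + _; apply. Qed.
Let tf k x : (k < M)%N -> t k <= x < t k.+1 -> f x = f (t k).
Proof. by case: ft => _ _ _; apply. Qed.

Lemma arcs_ge0 k : (k <= M)%N -> 0 <= t k.
Proof. by move=> kM; rewrite -t0; apply: (itv_partition_le tlt). Qed.

Lemma arcs_le1 k : (k <= M)%N -> t k <= 1.
Proof. by move=> kM; rewrite -tM; apply: (itv_partition_le tlt); rewrite kM /=. Qed.

Lemma arcs_gt0 : (0 < M)%N.
Proof. by case: (M) tM => //; rewrite t0 => /esym/eqP; rewrite oner_eq0. Qed.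

Lemma arc_start k : (k < M)%N -> arc t k (to_circle (t k)).
Proof. by move=> kM; exists (t k); rewrite //= in_itv /= lexx tlt. Qed.

Lemma arcP k x : (k < M)%N -> 0 <= x < 1 -> arc t k (to_circle x) ->
  t k <= x < t k.+1.
Proof.
move=> kM hx [y /=]; rewrite in_itv /= => hy /(@to_circle_inj R 0) <- //.
- have := arcs_ge0 (ltnW kM); have := arcs_le1 kM; lra.
- lra.
Qed.

Lemma arc_monochromatic k : (k < M)%N -> monochromatic f (arc t k).
Proof.
move=> kM x y hx hy /(arcP kM hx) ? /(arcP kM hy) ?.
by rewrite (tf kM (x := x)) // (tf kM (x := y)).
Qed.

Lemma segment_arc S : segment f S -> exists2 k, (k < M)%N & arc t k `<=` S.
Proof.
move=> sS; have [q Sq] := segment_nonempty sS.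
have [x hx qx] := to_circle_surj 0 q; rewrite add0r in hx.
have [|k kM kx] := @itv_partition R M t x; first by rewrite t0 tM.
exists k => //; apply: segment_absorb sS _ (arc_monochromatic kM) _.
  exact: connected_arc.
by exists q; split=> //; exists x; rewrite //= in_itv.
Qed.

Lemma nb_segments_arcs_le : (nb_segments f <= M)%N.
Proof.
apply: (@nb_segments_le f M (arc t)); last exact: segment_arc.
by move=> k kM; exists (to_circle (t k)); exact: arc_start.
Qed.

Lemma arcU_connected k : (k < M)%N ->
  connected (arc t k `|` arc t (k.+1 %% M)%N).
Proof.
move=> kM; have M0 := arcs_gt0.
pose b := t (k.+1 %% M)%N.+1; have bl : t (k.+1 %% M)%N < b.
  by apply: tlt; rewrite ltn_mod.
(* The last arc is followed by arc 0 across the point 0 of the circle; translating arc 0 by 1 makes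
   the union the image of a single interval. *)
pose z : int := if (k.+1 == M)%N then 1 else 0.
have tz : t k.+1 = t (k.+1 %% M)%N + z%:~R.
  rewrite /z; case: eqP => [->|kM']; first by rewrite modnn t0 tM add0r.
  by rewrite modn_small ?addr0 // ltn_neqAle kM andbT; exact/eqP.
rewrite (_ : _ `|` _ = @to_circle R @` `[t k, b + z%:~R[); first exact: connected_arc.
have kk := tlt kM.
apply/seteqP; split=> q.
  case=> -[x /=]; rewrite in_itv /= => hx <-.
    by exists x; rewrite //= in_itv /=; lra.
  exists (x + z%:~R); last exact: to_circle_shift.
  by rewrite /= in_itv /= -/b in hx *; lra.
case=> x /=; rewrite in_itv /= => hx <-; have [xk|xk] := ltP x (t k.+1).
  by left; exists x; rewrite //= in_itv /=; lra.
right; exists (x + (- z)%:~R); last exact: to_circle_shift.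
by rewrite /= in_itv /= -/b intrN; lra.
Qed.

(** A segment containing arc [k] absorbs the next arc, which has the same color. Hence every segment
    contains an arc other than [k], and [bump k] enumerates these [M - 1] arcs. *)
Lemma nb_segments_arcs_lt k : (1 < M)%N -> (k < M)%N ->
  f (t k) = f (t (k.+1 %% M)%N) -> (nb_segments f < M)%N.
Proof.
move=> M1 kM fkk; have M0 := ltnW M1; set k1 := (k.+1 %% M)%N in fkk *.
have k1M : (k1 < M)%N by rewrite ltn_mod.
have kk1 : k1 != k.
  rewrite /k1; have [kM'|kM'] := eqVneq k.+1 M; first by rewrite kM' modnn; lia.
  rewrite modn_small; lia.
have mU : monochromatic f (arc t k `|` arc t k1).
  have to_k x : 0 <= x < 1 -> (arc t k `|` arc t k1) (to_circle x) ->
      f x = f (t k).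
    move=> hx [/(arcP kM hx)/(tf kM) //|/(arcP k1M hx)/(tf k1M) ->//].
  by move=> x y hx hy Ax Ay; rewrite (to_k x) // (to_k y).
have [M' MM'] : exists M', M = M'.+1 by exists M.-1; rewrite prednK.
rewrite MM' ltnS; apply: (@nb_segments_le f M' (arc t \o bump k)).
  move=> j jM /=; exists (to_circle (t (bump k j))); apply: arc_start.
  by rewrite /bump; case: leqP => ?; lia.
have other j : (j < M)%N -> j != k -> exists2 i, (i < M')%N & bump k i = j.
  move=> jM jk; exists (unbump k j); last by rewrite unbumpKcond (negbTE jk).
  by rewrite /unbump; case: ltnP => ?; lia.
move=> S sS; have [j jM jS] := segment_arc sS.
have [jk|jk] := eqVneq j k; last first.
  by have [i iM' ij] := other j jM jk; exists i; rewrite //= ij.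
have [i iM' ij] := other k1 k1M kk1; exists i; rewrite //= ij.
apply: subset_trans (@subsetUr _ (arc t k) _) _.
apply: segment_absorb sS (arcU_connected kM) mU _.
exists (to_circle (t k)); split; last by left; exact: arc_start.
by apply: jS; rewrite jk; exact: arc_start.
Qed.

Hypothesis alt : forall k, (k < M)%N -> f (t k) <> f (t (k.+1 %% M)%N).

(* Inside its color class, the arc k is open because the arc k - 1 has the
   other color, and closed because the arc k + 1 has the other color. *)
Lemma arc_maximal k B : (k < M)%N -> connected B -> monochromatic f B ->
  arc t k `<=` B -> B = arc t k.
Proof.
move=> kM cB mB kB; have M0 := arcs_gt0; apply/esym/cB.
- by exists (to_circle (t k)); exact: arc_start.
- pose j := if k is k'.+1 then k' else M.-1; pose z : int := if k is 0 then 1 else 0.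
  have jM : (j < M)%N by rewrite /j; case: (k) kM => [|k'] ?; lia.
  have jk : (j.+1 %% M)%N = k.
    rewrite /j; case: (k) kM => [|k'] ?; first by rewrite prednK // modnn.
    by rewrite modn_small.
  have tj : t j.+1 = t k + z%:~R.
    rewrite /j /z; case: (k) => [|k']; last by rewrite addr0.
    by rewrite prednK // t0 tM add0r.
  have j0 := arcs_ge0 (ltnW jM); have j1 := arcs_le1 jM; have jj := tlt jM.
  exists (@to_circle R @` `]t j - z%:~R, t k.+1[); first exact: open_arc.
  apply/seteqP; split=> q.
    move=> kq; split; [exact: kB | case: kq => x /=].
    rewrite in_itv /= => hx <-; exists x; rewrite //= in_itv /=; lra.
  case=> Bq [x /=]; rewrite in_itv /= => hx xq; have [kx|kx] := leP (t k) x.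
    by exists x; rewrite //= in_itv /= kx; lra.
  exfalso; apply: (alt jM); rewrite jk -(tf jM (x := x + z%:~R)); last by lra.
  apply: mB; [lra | | | exact/kB/arc_start].
    by rewrite arcs_ge0 1?ltnW // (lt_le_trans (tlt kM)) // arcs_le1.
  by rewrite to_circle_shift xq.
- have k0 := arcs_ge0 (ltnW kM); have k1 := arcs_le1 kM; have kk := tlt kM.
  exists (~` (@to_circle R @` `]t k.+1, t k + 1[)).
    exact/open_closedC/open_arc.
  apply/seteqP; split=> q.
    move=> kq; split; [exact: kB | case: kq => x /=].
    rewrite in_itv /= => hx <- [y /=]; rewrite in_itv /= => hy.
    move=> /(@to_circle_inj R (t k)) yx; suff : y = x by lra.
    apply: yx; lra.
  case=> Bq notq; have [x hx qx] := to_circle_surj (t k) q.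
  have [kx|kx] := ltP x (t k.+1); first by exists x; rewrite //= in_itv /=; lra.
  have xk : x = t k.+1.
    apply/eqP; rewrite eq_le kx andbT leNgt; apply/negP => xk.
    by apply: notq; exists x; rewrite //= in_itv /= xk; lra.
  have tq : q = to_circle (t (k.+1 %% M)%N).
    rewrite qx xk; have [->|kM'] := eqVneq k.+1 M.
      by rewrite modnn t0 tM -(to_circle_shift 0 1) add0r.
    by rewrite modn_small // ltn_neqAle kM' kM.
  exfalso; apply: (alt kM); apply: mB.
  + by rewrite arcs_ge0 1?ltnW // (lt_le_trans (tlt kM)) // arcs_le1.
  + have lM : (k.+1 %% M < M)%N by rewrite ltn_mod.
    by rewrite arcs_ge0 1?ltnW // (lt_le_trans (tlt lM)) // arcs_le1.
  + exact/kB/arc_start.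
  + by rewrite -tq.
Qed.

(** The segments are exactly the arcs: each segment contains an arc, and arcs are already
    maximal. *)
Lemma nb_segments_arcs : nb_segments f = M.
Proof.
apply: card_fset_set; rewrite (_ : [set A | _] = arc t @` `I_M).
  apply: inj_card_eq => i j; rewrite !inE /= => iM jM ij.
  have ti : t i <= t i < t i.+1 by rewrite lexx tlt.
  have ti1 : 0 <= t i < 1.
    by rewrite arcs_ge0 1?ltnW // (lt_le_trans (tlt iM)) // arcs_le1.
  apply: (itv_partition_uniq tlt iM jM ti); apply: (arcP jM) => //.
  by rewrite -ij; exact: arc_start.
apply/seteqP; split=> [S /= sS|_ [k kM <-] /=].
  have [k kM kS] := segment_arc sS; exists k => //.
  by apply/esym/(arc_maximal kM) => //; case: sS.
split; [exact: connected_arc | exact: arc_monochromatic |].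
by move=> B cB mB kB; exact: arc_maximal.
Qed.

End Arcs.
End Segments.

(** * Effect of one iteration on a coloring *)

Section Step.
Variables (R : realType) (L : nat) (p : 'S_L) (c : nat -> R).
Hypothesis cuts : valid_cuts L c.
Implicit Types (f : coloring R) (x a b : R) (i : 'I_L).

Let c0 : c 0%N = 0. Proof. by case: cuts. Qed.
Let cL : c L = 1. Proof. by case: cuts. Qed.
Let clt j : (j < L)%N -> c j < c j.+1. Proof. by case: cuts => _ _; apply. Qed.

(** Extends [slot_start] to all natural indices, so that the right end of the line is the value at
    [L]. *)
Definition slot_pos (k : nat) : R := \sum_(j < L | (j < k)%N) slot_len p c j.

Lemma slot_pos0 : slot_pos 0 = 0.
Proof. by rewrite /slot_pos big1. Qed.

Lemma slot_posS i : slot_pos i.+1 = slot_pos i + slot_len p c i.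
Proof.
rewrite /slot_pos (bigD1 i) //= addrC; congr (_ + _); apply: eq_bigl => j.
by rewrite ltnS ltn_neqAle andbC.
Qed.

Lemma slot_posL : slot_pos L = 1.
Proof.
rewrite /slot_pos (eq_bigl predT) => [|i]; last by rewrite ltn_ord.
have -> : \sum_(i < L) slot_len p c i = \sum_(j < L) (c j.+1 - c j).
  by rewrite [RHS](reindex_inj (@perm_inj _ p)).
by rewrite -(big_mkord predT (fun j => c j.+1 - c j)) telescope_sumr // c0 cL subr0.
Qed.

Lemma slot_len_gt0 i : 0 < slot_len p c i.
Proof. by rewrite subr_gt0 clt. Qed.

Lemma slot_pos_lt k : (k < L)%N -> slot_pos k < slot_pos k.+1.
Proof. by move=> kL; rewrite (slot_posS (Ordinal kL)) ltrDl slot_len_gt0. Qed.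

Lemma iet_source_slot i x : slot_pos i <= x < slot_pos i.+1 ->
  iet_source p c x = c (p i) + (x - slot_pos i).
Proof.
move=> ix; rewrite /iet_source; case: pickP => [j|/(_ i)]; last first.
  by rewrite -[slot_start p c i]/(slot_pos i) -slot_posS ix.
rewrite -[slot_start p c j]/(slot_pos j) -slot_posS => jx.
suff -> : j = i by [].
exact/val_inj/(itv_partition_uniq slot_pos_lt _ _ jx ix).
Qed.

Lemma iet_step_slot f i a : c (p i) <= a < c (p i).+1 ->
  iet_step p c f (slot_pos i + (a - c (p i))) = f a.
Proof.
move=> ia; rewrite /iet_step (@iet_source_slot i); first by congr f; lra.
by rewrite slot_posS /slot_len; lra.
Qed.

Lemma iet_step_slot_pos f i : iet_step p c f (slot_pos i) = f (c (p i)).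
Proof.
rewrite -(@iet_step_slot f i) ?lexx ?clt //.
by rewrite subrr addr0.
Qed.

(** The interval from [u] to [v] of the new line is the translate of a monochromatic part [[a, b[]
    of a single piece of the old one. *)
Definition slot_arc f (u v : R) : Prop := exists i a b,
  [/\ u = slot_pos i + (a - c (p i)), v = slot_pos i + (b - c (p i)),
      c (p i) <= a < b, b <= c (p i).+1 & forall x, a <= x < b -> f x = f a].

Lemma slot_arc_full f i :
  (forall x, c (p i) <= x < c (p i).+1 -> f x = f (c (p i))) ->
  slot_arc f (slot_pos i) (slot_pos i.+1).
Proof.
move=> fi; exists i, (c (p i)), (c (p i).+1); split=> //.
- by rewrite subrr addr0.
- by rewrite slot_posS.
- by rewrite lexx clt.
Qed.

Lemma arcs_iet_step f (K : nat) (t : nat -> R) : t 0%N = 0 -> t K = 1 ->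
  (forall k, (k < K)%N -> slot_arc f (t k) (t k.+1)) ->
  arcs (iet_step p c f) K t.
Proof.
move=> t0 tK ft; split=> // k => [kK|x kK].
  by have [i [a [b [-> -> ab _ _]]]] := ft k kK; lra.
have [i [a [b [-> -> ab bi fab]]]] := ft k kK => ix.
have {1}-> : x = slot_pos i + ((x - slot_pos i + c (p i)) - c (p i)) by lra.
by rewrite !iet_step_slot 1?fab //; lra.
Qed.

(** * Iterations that cut only inside the first and the last arc *)

Section Refine.
Variables (f : coloring R) (M m : nat) (t : nat -> R) (s : 'I_L).
Hypothesis ft : arcs f M t.
Hypothesis M1 : (1 < M)%N.
Hypothesis ps : p s = m :> nat.
Hypothesis cm : c m < t 1%N.
Hypothesis cm1 : t M.-1 < c m.+1.

Let t0 : t 0%N = 0. Proof. by case: ft. Qed.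
Let tM : t M = 1. Proof. by case: ft. Qed.
Let tlt k : (k < M)%N -> t k < t k.+1. Proof. by case: ft => _ _ + _; apply. Qed.
Let tf k x : (k < M)%N -> t k <= x < t k.+1 -> f x = f (t k).
Proof. by case: ft => _ _ _; apply. Qed.
Let M0 : (0 < M)%N. Proof. exact: ltnW. Qed.
Let pL i : (p i < L)%N. Proof. exact: ltn_ord. Qed.
Let mL : (m < L)%N. Proof. by rewrite -ps. Qed.
Let cle k j : (k <= j <= L)%N -> c k <= c j.
Proof. exact: (itv_partition_le clt). Qed.

(** By [cm] the pieces before [m] lie in the first arc, and by [cm1] those after [m] lie in the last
    one; piece [m] contains all breakpoints strictly between 0 and 1. *)
Lemma color_low j x : (j < m)%N -> c j <= x < c j.+1 -> f x = f (t 0%N).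
Proof.
move=> jm jx; apply: tf => //; rewrite t0.
have jL : (j < L)%N by apply: ltn_trans jm mL.
have : c 0%N <= c j by apply: cle; rewrite /= ltnW.
have : c j.+1 <= c m by apply: cle; rewrite jm ltnW.
by have := cm; rewrite c0; lra.
Qed.

Lemma color_high j x : (m < j < L)%N -> c j <= x < c j.+1 -> f x = f (t M.-1).
Proof.
move=> /andP[mj jL] jx; apply: tf; first by rewrite prednK.
have : c m.+1 <= c j by apply: cle; rewrite mj ltnW.
have : c j.+1 <= c L by apply: cle; rewrite jL /=.
by have := cm1; rewrite prednK // tM cL; lra.
Qed.

Lemma color_mid : f (c m) = f (t 0%N).
Proof.
apply: tf => //; rewrite t0 cm andbT -c0; apply: cle; exact: ltnW.
Qed.

Lemma color_start j : (j < L)%N ->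
  f (c j) = if (j <= m)%N then f (t 0%N) else f (t M.-1).
Proof.
move=> jL; have cj : c j <= c j < c j.+1 by rewrite lexx clt.
have [jm|jm|->] := ltngtP j m; last exact: color_mid.
  by rewrite (color_low jm cj).
by rewrite (@color_high j) ?jm.
Qed.

Lemma color_piece i x : i != s -> c (p i) <= x < c (p i).+1 ->
  f x = f (c (p i)).
Proof.
move=> si ix; have ci : c (p i) <= c (p i) < c (p i).+1 by rewrite lexx clt.
have [im|im|] := ltngtP (p i) m.
- by rewrite (color_low im ix) (color_low im ci).
- have mi : (m < p i < L)%N by rewrite im pL.
  by rewrite (color_high mi ix) (color_high mi ci).
- by rewrite -ps => /val_inj /perm_inj /eqP; rewrite (negbTE si).
Qed.

(* The breakpoints t, with the ends of the line replaced by those of piece m. *)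
Definition inner (j : nat) : R :=
  if j is 0 then c m else if (j < M)%N then t j else c m.+1.

Lemma inner_lt j : (j < M)%N -> inner j < inner j.+1.
Proof.
move=> jM; rewrite /inner; case: j jM => [|j] jM; first by rewrite M1.
rewrite jM; case: ltnP => [_|Mj]; first exact: tlt.
by rewrite (_ : j.+1 = M.-1) //; lia.
Qed.

Lemma inner_itv j : (j <= M)%N -> c m <= inner j <= c m.+1.
Proof.
move=> jM; have inner_le k k' : (k <= k' <= M)%N -> inner k <= inner k'.
  exact: (itv_partition_le inner_lt).
have -> : c m.+1 = inner M by rewrite /inner; case: (M) M1 => // M' _; rewrite ltnn.
by rewrite -[c m]/(inner 0) !inner_le ?jM ?leqnn.
Qed.

Lemma color_inner j x : (j < M)%N -> inner j <= x < inner j.+1 ->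
  f x = f (t j).
Proof.
move=> jM jx; apply: tf => //; move: jx; rewrite /inner.
case: j jM => [|j] jM; first rewrite M1 t0.
  have : c 0%N <= c m by apply: cle; exact: ltnW.
  by rewrite c0; lra.
rewrite jM; case: ltnP => // Mj.
have jME : j.+2 = M by lia.
have : c m.+1 <= c L by apply: cle; rewrite mL leqnn.
by rewrite jME tM cL; lra.
Qed.

(** Breakpoints of the new line: every slot is one arc, except slot [s], which receives the [M] arcs
    of piece [m]. Later slots are therefore shifted by [M - 1] indices. *)
Definition refined (k : nat) : R :=
  if (k < s)%N then slot_pos k
  else if (k <= s + M)%N then slot_pos s + (inner (k - s) - c m)
  else slot_pos (k.+1 - M).

Lemma refined_low k : (k <= s)%N -> refined k = slot_pos k.
Proof.
rewrite /refined leq_eqVlt => /orP[/eqP->|->//].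
by rewrite ltnn leq_addr subnn /= subrr addr0.
Qed.

Lemma refined_mid j : (j <= M)%N ->
  refined (s + j) = slot_pos s + (inner j - c m).
Proof.
by move=> jM; rewrite /refined ltnNge leq_addr /= leq_add2l jM addKn.
Qed.

Lemma refined_high k : (s < k)%N -> refined (k + M.-1) = slot_pos k.
Proof.
move=> sk; rewrite /refined ifF; last by lia.
have [kM|kM] := leqP _ (s + M); last by congr slot_pos; lia.
have -> : k = s.+1 by lia.
rewrite slot_posS /slot_len ps (_ : _ - _ = M)%N; last by lia.
by rewrite /inner; case: (M) M1 => // M' _; rewrite ltnn.
Qed.

(* An arc ends either at the end of a slot i or in the interior of slot s. *)
Lemma refined_index k : (k < M + (L - 1))%N ->
  (exists i, k = if (i < s)%N then i : nat else (i + M.-1)%N) \/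
  (exists2 j, (j < M.-1)%N & k = (s + j)%N).
Proof.
move=> kM; have sL := ltn_ord s.
have [ks|sk] := ltnP k s.
  by left; exists (Ordinal (ltn_trans ks sL)); rewrite /= ks.
have [ksM|sMk] := ltnP k (s + M.-1).
  by right; exists (k - s)%N; lia.
have kL : (k - M.-1 < L)%N by lia.
by left; exists (Ordinal kL); rewrite /= ifF; lia.
Qed.

Lemma refined_mid_arc j : (j < M)%N ->
  slot_arc f (refined (s + j)) (refined (s + j).+1).
Proof.
move=> jM; have jj := inner_lt jM.
have h0 := inner_itv (ltnW jM); have h1 := inner_itv jM.
exists s, (inner j), (inner j.+1); rewrite ps; split.
- exact/refined_mid/ltnW.
- by rewrite -addnS refined_mid.
- by lra.
- by lra.
- move=> x jx; rewrite (color_inner jM jx) (color_inner jM (x := inner j)) //.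
  by rewrite lexx.
Qed.

Lemma arcs_refined : arcs (iet_step p c f) (M + (L - 1)) refined.
Proof.
apply: arcs_iet_step.
- by rewrite refined_low // slot_pos0.
- have sL := ltn_ord s; rewrite (_ : _ + _ = L + M.-1)%N; last by lia.
  by rewrite refined_high // slot_posL.
move=> k kM; have [[i ->]|[j jM ->]] := refined_index kM; last first.
  by apply: refined_mid_arc; lia.
have [iss|si|/val_inj->] := ltngtP i s.
- rewrite !refined_low ?(ltnW iss) //; apply: slot_arc_full => x.
  by apply: color_piece; rewrite -val_eqE neq_ltn iss.
- rewrite -addSn !refined_high //; last exact: leqW.
  by apply: slot_arc_full => x; apply: color_piece; rewrite -val_eqE neq_ltn si orbT.
- by apply: refined_mid_arc; lia.
Qed.

(** The index with the test [i <= s] is that of the first arc in slot [i]; with the test [i < s], as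
    used below, it is that of the last arc. They differ only at [i = s] and are the two sides of a
    junction. *)
Lemma refined_start i :
  refined (if (i <= s)%N then i : nat else (i + M.-1)%N) = slot_pos i.
Proof. by case: leqP => si; [exact: refined_low | exact: refined_high]. Qed.

Lemma color_refined_start i :
  iet_step p c f (refined (if (i <= s)%N then i : nat else (i + M.-1)%N)) =
  if (p i <= m)%N then f (t 0%N) else f (t M.-1).
Proof. by rewrite refined_start iet_step_slot_pos color_start. Qed.

Lemma color_refined_mid j : (j < M)%N ->
  iet_step p c f (refined (s + j)) = f (t j).
Proof.
move=> jM; have jj := inner_lt jM; have h1 := inner_itv jM.
have h0 := inner_itv (ltnW jM).
rewrite refined_mid ?(ltnW jM) // -ps iet_step_slot; last by rewrite ps; lra.
by rewrite (color_inner jM) // lexx.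
Qed.

Lemma color_refined_end i :
  iet_step p c f (refined (if (i < s)%N then i : nat else (i + M.-1)%N)) =
  if (p i < m)%N then f (t 0%N) else f (t M.-1).
Proof.
have [->|si] := eqVneq i s.
  by rewrite ps !ltnn color_refined_mid // prednK.
have pim : p i != m :> nat.
  by rewrite -ps; apply: contra_neq si => /val_inj /perm_inj.
by rewrite !(ltn_neqAle _ s, ltn_neqAle _ m) si pim color_refined_start.
Qed.

Lemma refined_next i :
  ((if (i < s)%N then i : nat else (i + M.-1)%N).+1 %% (M + (L - 1)))%N =
  if (ordS i <= s)%N then ordS i : nat else (ordS i + M.-1)%N.
Proof.
have iL := ltn_ord i; have sL := ltn_ord s; rewrite /=.
have [iL'|iL'] := eqVneq i.+1 L.
  rewrite iL' modnn leq0n ifF; last by lia.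
  by rewrite (_ : (i + _).+1 = M + (L - 1))%N ?modnn //; lia.
rewrite (modn_small (m := i.+1) (d := L)); last by lia.
by case: (ltnP i s) => si; rewrite modn_small; lia.
Qed.

(** Slot [i] ends in the left color exactly when [p i < m], and the next slot starts in the right
    color exactly when its piece comes after [m]. As the colors differ, there is a boundary when
    both or neither hold. *)
Lemma refined_junction i : f (t 0%N) <> f (t M.-1) ->
  iet_step p c f (refined (if (i < s)%N then i : nat else (i + M.-1)%N)) <>
  iet_step p c f (refined ((if (i < s)%N then i : nat else (i + M.-1)%N).+1
                             %% (M + (L - 1)))%N) <->
  (p i < m)%N = (m < p (ordS i))%N.
Proof.
move=> f01; rewrite refined_next color_refined_end color_refined_start.
case: (ltnP (p i) m) => _; case: (leqP (p (ordS i)) m) => _; split=> //.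
by move=> _ /esym.
Qed.

(** Boundaries between slots come from [alternates]; those inside slot [s] are old boundaries. The
    old boundary at 0 gives the different end colors needed at the junctions. *)
Lemma refined_alternating :
  (forall k, (k < M)%N -> f (t k) <> f (t (k.+1 %% M)%N)) ->
  alternates m p ->
  forall k, (k < M + (L - 1))%N ->
    iet_step p c f (refined k) <>
    iet_step p c f (refined (k.+1 %% (M + (L - 1)))%N).
Proof.
move=> falt palt k kM; have [[i ->]|[j jM ->]] := refined_index kM.
  apply/refined_junction; last exact: palt.
  have := falt M.-1; rewrite prednK // modnn => /(_ (leqnn _)) f10.
  by move/esym.
have sL := ltn_ord s; have jM' : (j.+1 < M)%N by lia.
rewrite modn_small; last by lia.
rewrite -addnS !color_refined_mid //; last exact: ltnW.
by have := falt j (ltnW jM'); rewrite modn_small.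
Qed.

End Refine.
End Step.

(** * Cuts confined to the two ends of the line *)

Section EndCuts.
Variable R : realType.

(** The cuts [0, ..., m] are equally spaced in [[0, a[], and the cuts [m + 1, ..., L] are equally
    spaced in []b, 1]]. *)
Definition end_cuts (L m : nat) (a b : R) (j : nat) : R :=
  if (j <= m)%N then a * (j%:R / m.+1%:R)
  else 1 - (1 - b) * ((L - j)%:R / (L - m)%:R).

Lemma end_cutsP (L m : nat) (a b : R) : (m < L)%N -> 0 < a -> a <= b -> b < 1 ->
  [/\ valid_cuts L (end_cuts L m a b), end_cuts L m a b m < a &
      b < end_cuts L m a b m.+1].
Proof.
move=> mL a0 ab b1.
have frac_lt (u v w : nat) : (u < v)%N -> (0 < w)%N ->
    u%:R / w%:R < v%:R / w%:R :> R.
  by move=> uv w0; rewrite ltr_pM2r ?invr_gt0 ?ltr_nat // ltr0n.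
have m_lt : end_cuts L m a b m < a.
  rewrite /end_cuts leqnn -[ltRHS]mulr1 ltr_pM2l //.
  by rewrite ltr_pdivrMr ?ltr0n // mul1r ltr_nat.
have lt_m1 : b < end_cuts L m a b m.+1.
  rewrite /end_cuts ltnn.
  have : (L - m.+1)%:R / (L - m)%:R < 1 :> R.
    by rewrite ltr_pdivrMr ?ltr0n ?subn_gt0 // mul1r ltr_nat; lia.
  have b1' : 0 < 1 - b by lra.
  by rewrite -(ltr_pM2l b1') mulr1; lra.
split=> //; split.
- by rewrite /end_cuts leq0n mul0r mulr0.
- by rewrite /end_cuts leqNgt mL subnn mul0r mulr0 subr0.
move=> j jL; have [jm|jm|->] := ltngtP j m; last 1 first.
- by apply: lt_trans m_lt _; apply: le_lt_trans lt_m1.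
- rewrite /end_cuts (ltnW jm) jm ltr_pM2l //; exact: frac_lt.
- rewrite /end_cuts !ifF; [|lia..]; rewrite ltrD2l ltrN2 ltr_pM2l; last by lra.
  by apply: frac_lt; lia.
Qed.

End EndCuts.

(** * The left-right initial condition and its first iteration *)

Section LeftRight.
Variable R : realType.
Let halves (k : nat) : R := k%:R / 2.

Lemma arcs_left_right : arcs (@left_right R) 2 halves.
Proof.
split; rewrite /halves ?mul0r ?divff ?pnatr_eq0 //.
  by move=> k _; rewrite ltr_pM2r ?ltr_nat // invr_gt0.
by move=> [|[|//]] x _; rewrite /left_right => hx; congr (if _ then _ else _);
  rewrite ?mul0r in hx *; apply/idP/idP; lra.
Qed.

Lemma left_right_alternating k : (k < 2)%N ->
  left_right (halves k) <> left_right (halves (k.+1 %% 2)%N).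
Proof.
have h0 : left_right (halves 0) = Black by rewrite /left_right /halves ifT //; lra.
have h1 : left_right (halves 1) = Gray by rewrite /left_right /halves ltxx.
by case: k => [|[|//]] _; rewrite ?h0 ?h1.
Qed.

(** If 1/2 is a cut, all pieces are monochromatic and at most [L] segments result. Otherwise the new
    line has [L + 1] arcs, and a junction without color change would make the count smaller. *)
Lemma first_step_alternates (L : nat) (p : 'S_L) (c : nat -> R) : (1 < L)%N ->
  valid_cuts L c ->
  nb_segments (iet_step p c (@left_right R)) = L.+1 ->
  exists2 m, (m < L)%N & alternates m p.
Proof.
move=> L1 cuts nbL; have [c0 cL clt] := cuts.
have [|m mL cm] := @itv_partition R L c (1 / 2); first by rewrite c0 cL; lra.
exists m => //; pose s := (p^-1)%g (Ordinal mL).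
have ps : p s = m :> nat by rewrite permKV.
have cle i j : (i <= j <= L)%N -> c i <= c j by exact: (itv_partition_le clt).
have [cmE|cmE] := eqVneq (c m) (1 / 2).
  have : (nb_segments (iet_step p c (@left_right R)) <= L)%N.
    apply: (@nb_segments_arcs_le R _ L (slot_pos p c)).
    apply: arcs_iet_step => //; [exact: slot_pos0 | exact: slot_posL |].
    move=> k kL; apply: (slot_arc_full cuts (i := Ordinal kL)) => x.
    set i := Ordinal kL; move: (ltn_ord (p i)); set j := nat_of_ord (p i).
    move=> jL jx; rewrite /left_right; congr (if _ then _ else _).
    have [jm|mj] := ltnP j m.
      have : c j.+1 <= c m by apply: cle; rewrite jm ltnW.
      by move=> cjm; apply/idP/idP; lra.
    have : c m <= c j by apply: cle; rewrite mj ltnW.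
    by move=> cmj; apply/idP/idP; lra.
  by rewrite nbL ltnn.
have cm1 : c m < halves 1 by rewrite lt_neqAle cmE /=; case/andP: cm.
have cm2 : halves 1 < c m.+1 by case/andP: cm.
have ref := arcs_refined cuts arcs_left_right (ltnSn 1) ps cm1 cm2.
have M' : (2 + (L - 1) = L.+1)%N by lia.
move=> i; apply/(refined_junction cuts arcs_left_right (ltnSn 1) ps cm1 cm2).
  exact: left_right_alternating (ltn0Sn 1).
move=> /(nb_segments_arcs_lt ref); rewrite M' nbL ltnn => H.
suff : false by []; apply: H; first by lia.
by have := ltn_ord i; case: (ltnP i s) => ?; lia.
Qed.

(** * Construction of the cuts for all iterations *)

Section Construction.
Variables (L m : nat) (p : 'S_L).
Hypotheses (mL : (m < L)%N) (palt : alternates m p).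
Let s : 'I_L := (p^-1)%g (Ordinal mL).
Let ps : p s = m :> nat. Proof. by rewrite permKV. Qed.

(* The breakpoints of the successive states do not depend on the colors, so the
   cuts of all the iterations can be defined by recursion on breakpoints. *)
Fixpoint breakpoints (N : nat) : nat * (nat -> R) :=
  if N is N'.+1 then
    let: (M, t) := breakpoints N' in
    ((M + (L - 1))%N,
     refined p (end_cuts L m (t 1%N) (t M.-1)) M m t s)
  else (2, halves).

(** Iteration [N] cuts the line left by iteration [N - 1], inside its first and last arcs. *)
Definition end_cuts_seq (N : nat) : nat -> R :=
  let: (M, t) := breakpoints N.-1 in end_cuts L m (t 1%N) (t M.-1).

Lemma arcs_end_cuts (f : coloring R) (M : nat) (t : nat -> R) :
  (1 < M)%N -> arcs f M t -> let c := end_cuts L m (t 1%N) (t M.-1) in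
  [/\ valid_cuts L c, c m < t 1%N & t M.-1 < c m.+1].
Proof.
move=> M1 [t0 tM tlt _]; have M0 := ltnW M1; apply: end_cutsP => //.
- by rewrite -t0; exact: tlt.
- by apply: (itv_partition_le tlt); lia.
- by rewrite -tM -{2}(prednK M0) tlt // prednK.
Qed.

(** The invariant includes the color change across the point 0, so the two ends of the line keep
    different colors and the next iteration can proceed in the same way. *)
Lemma iet_state_end_cuts (N : nat) :
  let: (M, t) := breakpoints N in
  let f := iet_state p end_cuts_seq (@left_right R) N in
  [/\ (1 < M)%N, arcs f M t &
      forall k, (k < M)%N -> f (t k) <> f (t (k.+1 %% M)%N)].
Proof.
elim: N => [|N]; first by split; [|exact: arcs_left_right|exact: left_right_alternating].
rewrite [breakpoints N.+1]/= [iet_state _ _ _ N.+1]/= /end_cuts_seq [N.+1.-1]/=.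
case: (breakpoints N) => M t; set f := iet_state _ _ _ N => -[M1 ft falt].
have [cuts cm cm1] := arcs_end_cuts M1 ft.
split; first by lia.
- exact: arcs_refined.
- exact: refined_alternating.
Qed.

Lemma valid_end_cuts_seq N : valid_cuts L (end_cuts_seq N).
Proof.
have := iet_state_end_cuts N.-1; rewrite /end_cuts_seq.
by case: (breakpoints _) => M t [M1 ft _]; case: (arcs_end_cuts M1 ft).
Qed.

Lemma nb_segments_breakpoints N :
  nb_segments (iet_state p end_cuts_seq (@left_right R) N) = (breakpoints N).1.
Proof.
have := iet_state_end_cuts N.
by case: (breakpoints N) => M t [_ ft falt]; exact: nb_segments_arcs ft falt.
Qed.

Lemma creates_segments_end_cuts :
  creates_segments p end_cuts_seq (@left_right R).
Proof.
by case=> // N _; rewrite !nb_segments_breakpoints /=; case: (breakpoints N).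
Qed.

End Construction.
End LeftRight.

Theorem proposition2p1 (R : realType) (L : nat) (hL : (2 <= L)%N) (p : 'S_L) :
  (exists c : nat -> nat -> R,
      (forall N : nat, (1 <= N)%N -> valid_cuts L (c N)) /\
      creates_segments p c (@left_right R))
  <->
  (odd L /\
   (special_form p \/
    exists s : 'S_L, special_form s /\ rotation_of s p)).
Proof.
rewrite -alternates_iff //; split=> [[c [cuts creates]]|[m mL palt]].
  (* Necessity is read off from the first iteration, which must raise the count from 2 to
     [L + 1]. *)
  apply: (@first_step_alternates R L p (c 1%N)) => //; first exact: cuts.
  have -> := creates 1%N isT.
  rewrite (nb_segments_arcs (arcs_left_right R)); first by lia.
  exact: left_right_alternating.
exists (end_cuts_seq R p mL); split.
  by move=> N _; exact: valid_end_cuts_seq.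
exact: creates_segments_end_cuts.
Qed.
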